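(* Let $D$ be the center of an $A_7^8(1)$-polytope $P$ in $4_{21}$. Then $f:=D/2+2K_{S_8}$ is a ruling in $\mathrm{Pic}\,S_8$. Furthermore, $D$ can be written as a sum of two centers of cornered $A_3^8(1)$-polytopes contained in $P$. There are exactly seven (unordered) pairs $\{D_1,D_2\}$ of centers of cornered $A_3^8(1)$-polytopes contained in $P$ with $D_1+D_2=D$, and these pairs correspond bijectively, via $D_i\mapsto D_i/2+K_{S_8}$, to the seven bipolar pairs of lines in the $7$-crosspolytope of $4_{21}$ given by the ruling $f$.
   Context: $S_8$ is a del Pezzo surface obtained by blowing up $\mathbb{P}^2$ at $8$ points (with $-K_{S_8}$ ample). $\mathrm{Pic}\,S_8=\mathbb{Z}h\oplus\mathbb{Z}e_1\oplus\dots\oplus\mathbb{Z}e_8$ with intersection form $h^2=1$, $h\cdot e_i=0$, $e_i\cdot e_j=-\delta_{ij}$, and $K_{S_8}=-3h+\sum_{i=1}^8 e_i$. A line is a class $l\in\mathrm{Pic}\,S_8$ with $l^2=l\cdot K_{S_8}=-1$; $L_8$ is the set of lines, which is the vertex set of the Gosset polytope $4_{21}$ (the convex hull of $L_8$). A ruling is a class $f\in\mathrm{Pic}\,S_8$ with $f^2=0$ and $f\cdot K_{S_8}=-2$. Rulings correspond to the $7$-crosspolytope facets of $4_{21}$: the vertices of the crosspolytope of $f$ are the lines $l$ with $f\cdot l=0$ (equivalently, such that $f-l$ is a line), and its bipolar (antipodal) pairs are the unordered pairs $\{l,l'\}\subset L_8$ with $l+l'=f$, $l\cdot l'=1$; there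 are seven of them. An $A_n^8(1)$-polytope in $4_{21}$ is a set of $n+1$ distinct lines in $L_8$ with pairwise intersection number $1$; its center is the sum of these lines. The vertex figure of $l\in L_8$ is $\{l'\in L_8: l'\cdot l=0\}$. An $A_n^8(1)$-polytope is cornered if there is a line $l\in L_8$ whose vertex figure contains all its lines; for a cornered $A_3^8(1)$-polytope with center $A$, the unique such line is $A/2+K_{S_8}$. *)

(* Defs.v *)
From mathcomp Require Import all_boot all_order all_algebra.
From mathcomp Require Import finmap.
From mathcomp Require Import boolp classical_sets functions cardinality.

Set Implicit Arguments.
Unset Strict Implicit.
Unset Printing Implicit Defensive.

Import Order.TTheory GRing.Theory Num.Theory.

Local Open Scope classical_set_scope.
Local Open Scope ring_scope.

(* Pic S_8 = Z h + Z e_1 + ... + Z e_8: coordinate 0 is the coefficient of h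
   and coordinate i + 1 (i : 'I_8, counted from 0) that of e_(i+1). *)
Notation Pic := 'rV[int]_9.
Notation PicQ := 'rV[rat]_9.

Definition toQ (x : Pic) : PicQ := map_mx intr x.

Definition cls_h : Pic := delta_mx 0 ord0.
Definition cls_e (i : 'I_8) : Pic := delta_mx 0 (lift ord0 i).

Definition inter (x y : Pic) : int :=
  x 0 ord0 * y 0 ord0
  - \sum_(i < 8) x 0 (lift ord0 i) * y 0 (lift ord0 i).

Lemma inter_hh : inter cls_h cls_h = 1.
Proof.
rewrite /inter !mxE !eqxx big1 ?subr0 // => i _.
by rewrite !mxE eq_sym (negPf (neq_lift _ _)) mulr0.
Qed.

Lemma inter_he i : inter cls_h (cls_e i) = 0.
Proof.
rewrite /inter !mxE !eqxx /= mulr0 big1 ?subr0 // => j _.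
by rewrite !mxE eq_sym (negPf (neq_lift _ _)) mul0r.
Qed.

Lemma inter_ee i j : inter (cls_e i) (cls_e j) = - (i == j)%:R.
Proof.
rewrite /inter !mxE !eqxx /= mulr0 sub0r (bigD1 i) //= big1 => [|k ki].
  by rewrite !mxE !eqxx (inj_eq lift_inj) /= mul1r addr0.
by rewrite !mxE (inj_eq lift_inj) (negPf ki) mul0r.
Qed.

Definition K8 : Pic := \sum_(i < 8) cls_e i - cls_h *+ 3.

Definition is_line (l : Pic) : Prop := inter l l = -1 /\ inter l K8 = -1.

Definition is_ruling (f : Pic) : Prop := inter f f = 0 /\ inter f K8 = -2.

Definition vertex_figure (l : Pic) : set Pic :=
  [set l' | is_line l' /\ inter l' l = 0].

(* A polytope is represented by its set of vertices. *)
Definition A_polytope (n : nat) (P : {fset Pic}) : Prop :=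
  [/\ #|` P|%fset = n.+1,
      forall l, l \in P -> is_line l
    & forall l l', l \in P -> l' \in P -> l != l' -> inter l l' = 1].

Definition center (P : {fset Pic}) : Pic := \sum_(l <- P) l.

Definition cornered (P : {fset Pic}) : Prop :=
  exists l, is_line l /\ [set` P] `<=` vertex_figure l.

Definition cornered_A3_center_in (P : {fset Pic}) (A : Pic) : Prop :=
  exists Q : {fset Pic},
    [/\ (Q `<=` P)%fset, A_polytope 3 Q, cornered Q & A = center Q].

Definition center_pairs (P : {fset Pic}) : set {fset Pic} :=
  [set S | exists D1 D2,
    [/\ cornered_A3_center_in P D1, cornered_A3_center_in P D2,
        D1 + D2 = center P & S = [fset D1; D2]%fset]].

Definition bipolar_pairs (f : Pic) : set {fset Pic} :=
  [set B | exists l l',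
    [/\ is_line l, is_line l', l + l' = f, inter l l' = 1
      & B = [fset l; l']%fset]].

Definition pair_toQ (B : {fset Pic}) : {fset PicQ} :=
  [fset toQ l | l in B]%fset.

(* A / 2 + K_{S_8}, which a priori lives only in Pic S_8 (x) Q. *)
Definition half_shift (A : Pic) : PicQ := 2^-1 *: toQ A + toQ K8.

Definition pair_half_shift (S : {fset Pic}) : {fset PicQ} :=
  [fset half_shift A | A in S]%fset.

(* Main.v *)
Require Import Defs.
From HB Require Import structures.
From mathcomp Require Import all_boot all_order all_algebra.
From mathcomp Require Import mxabelem.
From mathcomp Require Import zify ring.
From mathcomp Require Import finmap.
From mathcomp Require Import boolp classical_sets functions cardinality.

(** Translating by [K8] turns lines into roots: if [l] is a line then
    [l + K8] lies in the orthogonal of [K8], which is the negative definite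
    lattice E8, and has square -2; lines with intersection number 1 become
    orthogonal roots.  So the eight lines [l i] of the polytope give eight
    pairwise orthogonal roots [r i = l i + K8], and together with [K8] these
    form an orthogonal basis of Pic (x) Q: every class [v] satisfies
    [2 v = 2 (v.K) K - sum_i (v.r_i) r_i] (lemma [frame_expansion]).

    The arithmetic is carried by the binary code of the sets [J] of indices
    for which [sum_(i in J) r i] is twice a class.  Because the intersection
    form is unimodular, this code is self-dual, hence has 2^4 elements
    ([card_frame_code]); because E8 is even, all its weights are divisible
    by 4 ([card_frame_codeword]).  It is the extended Hamming code [8,4,4]:
    the empty word, the full word and 14 words of weight 4, paired by
    complementation into 7 pairs ([card_pointed_tetrads]).

    If [J] has four elements, a line [m] is orthogonal to the four lines
    [l i], [i] in [J], exactly when [2 m = sum_(i in J) l i + 2 K]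
    ([cornerP]), and such an [m] exists exactly when [J] is a codeword.  Hence
    the centers of cornered 3-simplices are the sums over words of weight 4,
    the pairs with sum [D] are the complementary pairs of words, and the map
    A |-> A / 2 + K sends a center to its corner.  The full word being in the
    code makes [f = D / 2 + 2 K] an integral class, and it is a ruling.

    The corners of complementary words add up to [f].  Conversely, if [m] is
    one of two lines with sum [f] and intersection number 1, then [f.m = 0],
    and the integers [a_i = m.r_i] have sum -4 and sum of squares 4.  Each
    [a_i (a_i + 1)] is nonnegative and they add up to 0, so [a_i] is -1 for
    four indices and 0 for the others: [m] is a corner
    ([orthogonal_line_corner]). *)

Set Implicit Arguments.
Unset Strict Implicit.
Unset Printing Implicit Defensive.

Import Order.TTheory GRing.Theory Num.Theory.

Local Open Scope classical_set_scope.
Local Open Scope card_scope.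
Local Open Scope ring_scope.

(** * The intersection form *)

Lemma interC x y : inter x y = inter y x.
Proof.
rewrite /inter mulrC; congr (_ - _).
by apply: eq_bigr => i _; rewrite mulrC.
Qed.

Lemma interBr x : zmod_morphism (inter x).
Proof.
move=> y z; rewrite /inter !mxE.
under eq_bigr do rewrite !mxE mulrBr.
by rewrite sumrB; ring.
Qed.

HB.instance Definition _ x :=
  GRing.isZmodMorphism.Build Pic int (inter x) (interBr x).

Lemma interZr x a y : inter x (a *: y) = a * inter x y.
Proof.
rewrite /inter mulrBr mxE mulrCA; congr (_ - _).
by rewrite mulr_sumr; apply: eq_bigr => i _; rewrite mxE mulrCA.
Qed.

Lemma interDr x y z : inter x (y + z) = inter x y + inter x z.
Proof. exact: raddfD. Qed.

Lemma interMnr x y n : inter x (y *+ n) = inter x y *+ n.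
Proof. exact: raddfMn. Qed.

Lemma inter_sumr (I : finType) (J : {set I}) x (F : I -> Pic) :
  inter x (\sum_(i in J) F i) = \sum_(i in J) inter x (F i).
Proof. exact: raddf_sum. Qed.

Lemma interDl x y z : inter (x + y) z = inter x z + inter y z.
Proof. by rewrite interC interDr !(interC z). Qed.

Lemma inter_suml (I : finType) (J : {set I}) (F : I -> Pic) z :
  inter (\sum_(i in J) F i) z = \sum_(i in J) inter (F i) z.
Proof. by rewrite interC inter_sumr; apply: eq_bigr => i _; rewrite interC. Qed.

Lemma interMnl x y n : inter (x *+ n) y = inter x y *+ n.
Proof. by rewrite interC interMnr interC. Qed.

Lemma lift0_eq0 (i : 'I_8) : (lift ord0 i == 0 :> 'I_9) = false.
Proof. by []. Qed.

Lemma K8E j : K8 0 j = if j == 0 then -3 else 1.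
Proof.
rewrite /K8 !mxE summxE eqxx /=; case: (unliftP ord0 j) => [i ->|->].
  rewrite lift0_eq0 -!mulrnDr mulr0n subr0 (bigD1 i) //=.
  rewrite big1 => [|k ki]; first by rewrite !mxE !eqxx addr0.
  by rewrite !mxE (inj_eq lift_inj) eq_sym (negPf ki) andbF.
by rewrite eqxx big1 // => i _; rewrite !mxE (negPf (neq_lift _ _)) andbF.
Qed.

Lemma interK8 x : inter x K8 = - (3 * x 0 ord0) - \sum_(i < 8) x 0 (lift ord0 i).
Proof.
rewrite /inter K8E eqxx mulrN mulrC; congr (_ - _).
by apply: eq_bigr => i _; rewrite K8E lift0_eq0 mulr1.
Qed.

Lemma interKK : inter K8 K8 = 1.
Proof.
rewrite interK8 K8E eqxx (eq_bigr (fun=> 1)) => [|i _]; last first.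
  by rewrite K8E lift0_eq0.
by rewrite sumr_const card_ord.
Qed.

Lemma dvdz2_mulS (a : int) : (2 %| a * (a + 1))%Z.
Proof.
have : (2 %| a)%Z || (2 %| a + 1)%Z by lia.
by case/orP => ?; [apply: dvdz_mulr | apply: dvdz_mull].
Qed.

(** The coordinates of [K8] are all odd, so [x.x + x.K8] has the parity of a
    sum of products of consecutive integers.  In particular the orthogonal of
    [K8] is an even lattice. *)
Lemma K8_characteristic x : (2 %| inter x x + inter x K8)%Z.
Proof.
rewrite interK8 /inter.
set a := x 0 ord0.
have -> : a * a - \sum_(i < 8) x 0 (lift ord0 i) * x 0 (lift ord0 i)
    + (- (3 * a) - \sum_(i < 8) x 0 (lift ord0 i))
  = a * (a + 1) - 2 * 2 * a
    - \sum_(i < 8) x 0 (lift ord0 i) * (x 0 (lift ord0 i) + 1).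
  under [in RHS]eq_bigr do rewrite mulrDr mulr1.
  by rewrite big_split /=; ring.
rewrite rpredB ?rpredB ?dvdz2_mulS //.
  by rewrite -mulrA dvdz_mulr.
by apply: rpred_sum => i _; apply: dvdz2_mulS.
Qed.

(** * Expansion in an orthogonal frame of roots *)

Definition root_frame (r : 'I_8 -> Pic) : Prop :=
  (forall i j, inter (r i) (r j) = - 2 *+ (i == j)) /\
  (forall i, inter (r i) K8 = 0).

Definition gram : 'M[int]_9 := diag_mx (\row_j (if j == 0 then 1 else -1)).

Lemma inter_mx x y : inter x y = (x *m gram *m y^T) 0 0.
Proof.
rewrite /inter mxE [RHS]big_ord_recl -sumrN; congr (_ + _).
  by rewrite mul_mx_diag !mxE eqxx mulr1.
apply: eq_bigr => i _.
by rewrite mul_mx_diag !mxE lift0_eq0 mulrN1 mulNr.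
Qed.

(** Nine pairwise orthogonal vectors of nonzero square in rank 9 form a basis
    over the rationals: the product of their matrix with the Gram matrix and
    its own transpose is diagonal with nonzero entries, so no nonzero class
    is orthogonal to all nine. *)
Lemma frame_nondegenerate r u : root_frame r ->
  inter u K8 = 0 -> (forall i, inter u (r i) = 0) -> u = 0.
Proof.
move=> [hrr hrK] huK hur.
pose b (k : 'I_9) := if unlift ord0 k is Some i then r i else K8.
pose M : 'M[int]_9 := \matrix_k b k.
have bE x : x *m (gram *m M^T) = \row_k inter x (b k).
  apply/rowP => k; rewrite mulmxA !mxE inter_mx mxE; apply: eq_bigr => j _.
  by rewrite !mxE.
have MGM : M *m (gram *m M^T)
    = diag_mx (\row_k (if k == 0 then 1 else -2)).
  apply/row_matrixP => k; rewrite row_mul rowK bE; apply/rowP => l.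
  rewrite !mxE /b; case: (unliftP ord0 k) => [i ->|->];
    case: (unliftP ord0 l) => [j ->|->].
  - by rewrite hrr (inj_eq lift_inj) lift0_eq0.
  - by rewrite hrK eq_sym (negPf (neq_lift _ _)).
  - by rewrite interC hrK (negPf (neq_lift _ _)).
  - by rewrite interKK !eqxx.
(* Nonvanishing of the whole determinant gives that of its right factor. *)
have detGM : \det (gram *m M^T) != 0.
  have : \det (M *m (gram *m M^T)) != 0.
    rewrite MGM det_diag; apply/prodf_neq0 => k _.
    by rewrite mxE; case: ifP.
  by rewrite det_mulmx mulf_eq0 negb_or => /andP[].
apply/eqP; apply: contraNT detGM => u0; apply/det0P; exists u => //.
rewrite bE; apply/rowP => k; rewrite !mxE /b.
by case: (unlift _ _).
Qed.

(** Both sides have the same intersection numbers with [K8] and with every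
    [r i].  The factor 2 clears the denominators coming from [(r i).(r i) = -2]. *)
Lemma frame_expansion r v : root_frame r ->
  v *+ 2 = (2 * inter v K8) *: K8 - \sum_i inter v (r i) *: r i.
Proof.
move=> hr; have [hrr hrK] := hr; apply/eqP; rewrite -subr_eq0; apply/eqP.
apply: (frame_nondegenerate hr) => [|j];
  rewrite interC (interBr _ (v *+ 2)) (interBr _ (_ *: K8)) interMnr interZr.
  rewrite interKK raddf_sum big1 => [|i _] /=.
    by rewrite (interC K8 v); ring.
  by rewrite interZr (interC K8) hrK mulr0.
rewrite hrK raddf_sum (bigD1 j) //= big1 => [|i ij] /=.
  by rewrite interZr hrr eqxx (interC (r j) v) /=; ring.
by rewrite interZr hrr eq_sym (negPf ij) mulr0n mulr0.
Qed.

Lemma frame_parseval r v w : root_frame r ->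
  inter v w *+ 2 = 2 * inter v K8 * inter w K8
                   - \sum_i inter v (r i) * inter w (r i).
Proof.
move=> hr; rewrite -interMnl (frame_expansion v hr) interC.
rewrite (interBr _ (_ *: K8)) interZr.
by rewrite raddf_sum; congr (_ - _); apply: eq_bigr => i _ /=; rewrite interZr.
Qed.

(** * The binary code of a frame of eight orthogonal roots *)

Definition mod2 (u : Pic) : 'rV['F_2]_9 := map_mx intr u.

Lemma mod2_eq0P u : reflect (exists w, u = w *+ 2) (mod2 u == 0).
Proof.
apply: (iffP eqP) => [u0|[w ->]].
  exists (map_mx (divz^~ 2) u); apply/rowP => j; rewrite !mxE.
  have : (u 0 j)%:~R == 0 :> 'F_2.
    by move/rowP: u0 => /(_ j); rewrite !mxE => ->.
  by rewrite -(dvdz_pcharf (pchar_Fp (isT : prime 2))) => /divzK {1}<-; ring.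
apply/rowP => j; rewrite !mxE; apply/eqP.
rewrite -(dvdz_pcharf (pchar_Fp (isT : prime 2))).
by rewrite -mulr2n -mulr_natr dvdz_mull.
Qed.

(** Signs disappear modulo 2, so the intersection form reduces to the standard
    scalar product. *)
Lemma inter_mod2 x y : (inter x y)%:~R = (mod2 x *m (mod2 y)^T) 0 0.
Proof.
rewrite /inter rmorphB rmorphM rmorph_sum [RHS]mxE [RHS]big_ord_recl !mxE -sumrN.
congr (_ + _); apply: eq_bigr => i _.
by rewrite rmorphM !mxE oppr_pchar2 ?pchar_Fp.
Qed.

Definition indicator (J : {set 'I_8}) : 'rV['F_2]_8 := \row_i (i \in J)%:R.

Lemma indicator_inj : injective indicator.
Proof.
move=> J J' /rowP eJ; apply/setP => i; move: (eJ i); rewrite !mxE.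
by do 2!case: (_ \in _).
Qed.

Lemma indicator_support (c : 'rV['F_2]_8) : indicator [set i | c 0 i != 0]%SET = c.
Proof.
apply/rowP => i; rewrite mxE finset.inE; case: (c 0 i) => [[|[|//]] lt_i];
  exact: val_inj.
Qed.

Definition frame_mx (r : 'I_8 -> Pic) : 'M['F_2]_(8, 9) := \matrix_i mod2 (r i).

Lemma indicator_mul r J : indicator J *m frame_mx r = mod2 (\sum_(i in J) r i).
Proof.
apply/rowP => j; rewrite !mxE summxE rmorph_sum [RHS]big_mkcond /=.
by apply: eq_bigr => i _; rewrite !mxE; case: ifP; rewrite (mul1r, mul0r).
Qed.

Definition frame_code (r : 'I_8 -> Pic) : {set {set 'I_8}} :=
  [set J : {set 'I_8} | mod2 (\sum_(i in J) r i) == 0]%SET.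

Lemma frame_codeP r (J : {set 'I_8}) :
  reflect (exists w, \sum_(i in J) r i = w *+ 2) (J \in frame_code r).
Proof. by rewrite finset.inE; apply: mod2_eq0P. Qed.

(** A codeword can be read off half of its sum of roots, by intersecting with
    the frame: this is what makes the code self-dual. *)
Lemma inter_half_sum r (J : {set 'I_8}) w i :
  root_frame r -> \sum_(j in J) r j = w *+ 2 ->
  inter w (r i) = - (i \in J)%:R.
Proof.
move=> [hrr _] hw; have : inter (w *+ 2) (r i) = (- (i \in J)%:R) *+ 2.
  rewrite -hw inter_suml; case: (boolP (i \in J)) => iJ.
    rewrite (bigD1 i) //= big1 => [|j /andP[_ ji]]; last first.
      by rewrite hrr (negPf ji).
    by rewrite hrr eqxx.
  rewrite big1 => [|j jJ]; first by rewrite oppr0 mul0rn.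
  by rewrite hrr; case: eqP iJ => // <-; rewrite jJ.
by rewrite interMnl !mulr2n; case: (_ \in _); lia.
Qed.

(** The code is the left kernel of the reduction [A] of the frame modulo 2, of
    dimension [8 - rank A].  The roots being orthogonal of even square,
    [A A^T = 0], which bounds the rank by half of 9.  Conversely a vector [c]
    of the kernel comes from a class [w] with [2 w = sum_i c_i r_i], and [c] is
    then the vector of the [w.r_i] modulo 2: the kernel is contained in the
    column space of [A], so [8 - rank A <= rank A]. *)
Lemma rank_frame_mx r : root_frame r -> \rank (frame_mx r) = 4%N.
Proof.
move=> hr; have [hrr _] := hr; apply/eqP; rewrite eqn_leq; apply/andP; split.
  have /mulmx0_rank_max : frame_mx r *m (frame_mx r)^T = 0.
    apply/matrixP => i j.
    have -> : (frame_mx r *m (frame_mx r)^T) i j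
            = (mod2 (r i) *m (mod2 (r j))^T) 0 0.
      by rewrite !mxE; apply: eq_bigr => k _; rewrite !mxE.
    by rewrite -inter_mod2 hrr mxE; case: eqP => // _; apply/eqP.
  by rewrite mxrank_tr; lia.
have /mxrankS : (kermx (frame_mx r) <= (frame_mx r)^T)%MS.
  apply/rV_subP => c /sub_kermxP; rewrite -[c]indicator_support.
  set J := [set _ | _]%SET; rewrite indicator_mul => /eqP/mod2_eq0P[w hw].
  apply/submxP; exists (mod2 w); apply/rowP => i.
  have -> : (mod2 w *m (frame_mx r)^T) 0 i = (mod2 w *m (mod2 (r i))^T) 0 0.
    by rewrite !mxE; apply: eq_bigr => k _; rewrite !mxE.
  rewrite -inter_mod2 (inter_half_sum i hr hw) mxE.
  by case: (_ \in _); apply/eqP.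
by rewrite mxrank_ker mxrank_tr; lia.
Qed.

Lemma card_frame_code r : root_frame r -> #|frame_code r| = 16%N.
Proof.
move=> hr; rewrite -(card_imset _ indicator_inj).
have -> : [set indicator J | J in frame_code r]%SET = rowg (kermx (frame_mx r)).
  apply/setP => c; rewrite mem_rowg -[c]indicator_support (mem_imset _ _ indicator_inj).
  by rewrite finset.inE -indicator_mul; apply/eqP/sub_kermxP.
by rewrite card_rowg mxrank_ker rank_frame_mx // card_Fp.
Qed.

(** If [2 w = sum_(i in J) r i] then [w.w = - #|J| / 2], and this is even since
    [w] is orthogonal to the characteristic vector [K8]. *)
Lemma card_frame_codeword r (J : {set 'I_8}) :
  root_frame r -> J \in frame_code r -> (4 %| #|J|)%N.
Proof.
move=> hr /frame_codeP[w hw]; have [_ hrK] := hr.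
have wK : inter w K8 = 0.
  have : inter (w *+ 2) K8 = 0 by rewrite -hw inter_suml big1.
  by rewrite interMnl; lia.
have ww : inter w w *+ 2 = - #|J|%:R.
  rewrite -interMnr -hw inter_sumr (eq_bigr (fun=> -1)) => [|i iJ].
    by rewrite sumr_const mulNrn.
  by rewrite (inter_half_sum i hr hw) iJ.
have := K8_characteristic w; rewrite wK addr0.
by lia.
Qed.

(** A form which is unimodular stays nondegenerate modulo 2. *)
Lemma mod2_unimodular u : (forall v, (2 %| inter v u)%Z) -> mod2 u = 0.
Proof.
move=> hu; apply/rowP => j; rewrite [RHS]mxE.
have -> : mod2 u 0 j = (inter (delta_mx 0 j) u)%:~R.
  by rewrite inter_mod2 /mod2 map_delta_mx -rowE !mxE.
by apply/eqP; rewrite -(dvdz_pcharf (pchar_Fp (isT : prime 2))).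
Qed.

(** For every class [v], the sum of the [v.r_i] has the parity of the sum of
    their squares, which the Parseval identity shows to be even. *)
Lemma frame_code_setT r : root_frame r -> [set: 'I_8]%SET \in frame_code r.
Proof.
move=> hr; rewrite finset.inE; apply/eqP/mod2_unimodular => v.
rewrite inter_sumr; under eq_bigl do rewrite finset.inE.
have sq : \sum_i inter v (r i) * inter v (r i)
        = 2 * (inter v K8 * inter v K8 - inter v v).
  by move: (frame_parseval v v hr); lia.
have -> : \sum_i inter v (r i) = \sum_i inter v (r i) * (inter v (r i) + 1)
                                - \sum_i inter v (r i) * inter v (r i).
  by rewrite -sumrB; apply: eq_bigr => i _; ring.
rewrite rpredB //; last by rewrite sq dvdz_mulr.
by apply: rpred_sum => i _; apply: dvdz2_mulS.
Qed.

Lemma sum_setC (V : zmodType) (I : finType) (F : I -> V) (J : {set I}) :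
  \sum_(i in ~: J) F i = \sum_i F i - \sum_(i in J) F i.
Proof.
rewrite [\sum_i F i](bigID (mem J)) /= addrAC subrr add0r.
by apply: eq_bigl => i; rewrite finset.inE.
Qed.

Lemma frame_code_setC r (J : {set 'I_8}) : root_frame r ->
  J \in frame_code r -> ~: J \in frame_code r.
Proof.
move=> hr /frame_codeP[w hw]; have /frame_codeP[t ht] := frame_code_setT hr.
apply/frame_codeP; exists (t - w); rewrite sum_setC hw mulrnBl -ht.
by congr (_ - _); apply: eq_bigl => i; rewrite finset.inE.
Qed.

(** Requiring [ord0 \in J] selects one word from each pair of complementary
    codewords of weight 4. *)
Definition pointed_tetrads (r : 'I_8 -> Pic) : {set {set 'I_8}} :=
  [set J in frame_code r | (ord0 \in J) && (#|J| == 4)%N]%SET.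

(** Complementation exchanges the codewords which contain [ord0] with those
    which do not, so there are eight of the former; their weight is 4 or 8,
    and only the full word has weight 8. *)
Lemma card_pointed_tetrads r : root_frame r -> #|pointed_tetrads r| = 7%N.
Proof.
move=> hr; pose B := [set J : {set 'I_8} | ord0 \in J]%SET.
have cardB : #|frame_code r :&: B| = 8%N.
  have : #|frame_code r :&: B| = #|frame_code r :\: B|.
    rewrite -(card_imset _ (can_inj (@finset.setCK _))); apply: eq_card => J.
    have inB (J' : {set 'I_8}) : (J' \in B) = (ord0 \in J') by rewrite finset.inE.
    apply/imsetP/idP => [[J' + ->]|].
      rewrite finset.in_setI finset.in_setD !inB finset.in_setC negbK.
      by move=> /andP[/(frame_code_setC hr) -> ->].
    rewrite finset.in_setD inB => /andP[J0 /(frame_code_setC hr) hJ].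
    exists (~: J); last by rewrite finset.setCK.
    by rewrite finset.in_setI hJ inB finset.in_setC.
  move=> eB; rewrite -[LHS]doubleK -addnn {2}eB cardsID card_frame_code //.
have -> : pointed_tetrads r = (frame_code r :&: B) :\ [set: 'I_8]%SET.
  apply/setP => J; rewrite finset.in_setD1 finset.in_setI [J \in B]finset.inE.
  rewrite [LHS]finset.inE andbCA [RHS]andbC -andbA.
  case: (boolP (J \in _)) => //= hJ; case: (boolP (ord0 \in J)) => //= J0.
  have /dvdnP[k hk] := card_frame_codeword hr hJ.
  have J_gt0 : (0 < #|J|)%N by apply/card_gt0P; exists ord0.
  have J_le8 : (#|J| <= 8)%N by apply: (leq_trans (max_card _)); rewrite card_ord.
  rewrite eqEcard finset.subsetT cardsT card_ord /=.
  by move: #|J| hk J_gt0 J_le8 => n; lia.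
have := cardsD1 [set: 'I_8]%SET (frame_code r :&: B).
rewrite cardB finset.in_setI frame_code_setT // finset.inE finset.in_setT.
by rewrite add1n => -[].
Qed.

(** * Eight lines with pairwise intersection number 1 *)

Definition line_frame (l : 'I_8 -> Pic) : Prop :=
  (forall i, is_line (l i)) /\ (forall i j, i != j -> inter (l i) (l j) = 1).

(** The bijection between the lines of the del Pezzo surface and the roots of
    the E8 lattice orthogonal to [K8]. *)
Definition line_root (l : 'I_8 -> Pic) (i : 'I_8) : Pic := l i + K8.

Lemma line_frame_inter l i j : line_frame l ->
  inter (l i) (l j) = 1 - 2 *+ (i == j).
Proof.
move=> [hl hll]; case: eqP => [<-|/eqP/hll -> //].
by case: (hl i) => ->.
Qed.

Lemma inter_root x y : inter x (y + K8) = inter x y + inter x K8.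
Proof. exact: interDr. Qed.

Lemma inter_rootl x y : inter (x + K8) y = inter x y + inter K8 y.
Proof. exact: interDl. Qed.

Lemma inter_line_root l i j : line_frame l ->
  inter (l i) (line_root l j) = - 2 *+ (i == j).
Proof.
move=> hl; rewrite inter_root line_frame_inter //; case: hl => hl _.
by case: (hl i) => _ ->; case: eqP.
Qed.

Lemma inter_root_K8 l i : line_frame l -> inter (line_root l i) K8 = 0.
Proof. by move=> [hl _]; rewrite inter_rootl interKK; case: (hl i) => _ ->. Qed.

Lemma roots_frame l : line_frame l -> root_frame (line_root l).
Proof.
move=> hl; split=> [i j|i]; last exact: inter_root_K8.
by rewrite inter_rootl inter_line_root // interC inter_root_K8 // addr0.
Qed.

Lemma sum_roots l (J : {set 'I_8}) :
  \sum_(i in J) line_root l i = \sum_(i in J) l i + K8 *+ #|J|.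
Proof. by rewrite big_split sumr_const. Qed.

Lemma sum_lines_inj l : line_frame l ->
  injective (fun J : {set 'I_8} => \sum_(i in J) l i).
Proof.
move=> hl J J' eJ; apply/setP => i.
have E (J1 : {set 'I_8}) :
    inter (\sum_(j in J1) l j) (line_root l i) = - 2 *+ (i \in J1).
  rewrite inter_suml; case: (boolP (i \in J1)) => iJ.
    rewrite (bigD1 i) //= big1 => [|j /andP[_ ji]].
      by rewrite inter_line_root // eqxx.
    by rewrite inter_line_root // (negPf ji).
  rewrite big1 // => j jJ; rewrite inter_line_root //.
  by case: eqP iJ => // <-; rewrite jJ.
by have := E J; rewrite eJ E; do 2!case: (_ \in _).
Qed.

(** By the Parseval identity and [m.m = m.K8 = -1].  Since the coordinates are
    integers, either four of them are 1 or -1, or a single one is 2 or -2. *)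
Lemma line_sum_sq l m : line_frame l -> is_line m ->
  \sum_i inter m (line_root l i) * inter m (line_root l i) = 4.
Proof.
move=> hl [mm mK]; have := frame_parseval m m (roots_frame hl).
by rewrite mm mK; lia.
Qed.

Lemma mulrn2_inj : injective (fun x : Pic => x *+ 2).
Proof.
move=> x y /rowP e; apply/rowP => j; move: (e j); rewrite !mulr2n !mxE.
by move: (x 0 j) (y 0 j) => a b; lia.
Qed.

(** The corner of a simplex is determined by its four lines [l i], [i] in [J].
    Given a corner [m], its coordinates [m.r_i] are -1 on [J], and this already
    exhausts the sum of squares 4 of [line_sum_sq]; the other coordinates
    therefore vanish and [frame_expansion] gives the formula.  Conversely the
    formula says that [m + K8] is half of the sum of the four roots, from which
    all intersection numbers follow. *)
Lemma cornerP l (J : {set 'I_8}) m : line_frame l -> #|J| = 4%N ->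
  m *+ 2 = \sum_(i in J) l i + K8 *+ 2 <->
  is_line m /\ (forall i, i \in J -> inter (l i) m = 0).
Proof.
move=> hl J4; have hr := roots_frame hl; split=> [hm | [hm hJ]].
  have hw : \sum_(i in J) line_root l i = (m + K8) *+ 2.
    by rewrite sum_roots J4 (mulrnDl _ m) hm -addrA -mulrnDr.
  have wr i := inter_half_sum i hr hw.
  have wK : inter (m + K8) K8 = 0.
    have : inter ((m + K8) *+ 2) K8 = 0.
      by rewrite -hw inter_suml big1 // => i _; case: hr.
    by rewrite interMnl; lia.
  have ww : inter (m + K8) (m + K8) = -2.
    have : inter (m + K8) ((m + K8) *+ 2) = -4.
      rewrite -hw inter_sumr (eq_bigr (fun=> -1)) => [|i iJ].
        by rewrite sumr_const J4.
      by rewrite wr iJ.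
    by rewrite interMnr; lia.
  have mK : inter m K8 = -1 by move: wK; rewrite inter_rootl interKK; lia.
  split.
    by split=> //; move: ww; rewrite inter_root inter_rootl wK (interC K8) mK; lia.
  move=> i iJ; move: (wr i); rewrite iJ inter_root wK inter_rootl (interC K8).
  by case: hl => hl _; case: (hl i) => _ ->; rewrite (interC m); lia.
have mr_in i : i \in J -> inter m (line_root l i) = -1.
  by move=> iJ; rewrite inter_root interC hJ //; case: hm => _ ->.
have mr_out i : i \notin J -> inter m (line_root l i) = 0.
  move=> iJ; have := line_sum_sq hl hm.
  rewrite (bigID (mem J)) /= (eq_bigr (fun=> 1)) => [|j jJ]; last by rewrite mr_in.
  rewrite sumr_const J4 -[RHS]addr0 => /addrI/eqP.
  rewrite psumr_eq0 => [/allP/(_ i)|j _]; last by rewrite -expr2 sqr_ge0.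
  by rewrite mem_index_enum iJ mulf_eq0 orbb => /(_ isT)/eqP.
rewrite (frame_expansion m hr); case: (hm) => _ ->.
rewrite (bigID (mem J)) /= [X in - (_ + X)]big1 => [|i iJ]; last first.
  by rewrite mr_out ?scale0r.
rewrite (eq_bigr (fun i => - line_root l i)) => [|i iJ]; last first.
  by rewrite mr_in ?scaleN1r.
rewrite sumrN addr0 opprK sum_roots J4 addrC -addrA; congr (_ + _).
by rewrite mulrN1 scaleNr scaler_nat -mulrnBr.
Qed.

Lemma tetrad_cornerP l (J : {set 'I_8}) : line_frame l -> #|J| = 4%N ->
  J \in frame_code (line_root l) <-> exists m, m *+ 2 = \sum_(i in J) l i + K8 *+ 2.
Proof.
move=> hl J4; split=> [/frame_codeP[w]|[m hm]].
  rewrite sum_roots J4 => hw; exists (w - K8).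
  by rewrite (mulrnBl _ w) -hw -addrA -mulrnBr.
apply/frame_codeP; exists (m + K8).
by rewrite sum_roots J4 (mulrnDl _ m) hm -addrA -mulrnDr.
Qed.

(** Here the coordinates [a i] of [m] have sum -4, by orthogonality to [f], and
    sum of squares 4, so the nonnegative integers [a i * (a i + 1)] have sum 0
    and all coordinates are 0 or -1. *)
Lemma orthogonal_line_corner l f m : line_frame l ->
  f *+ 2 = \sum_i l i + K8 *+ 4 -> is_line m -> inter f m = 0 ->
  exists2 J : {set 'I_8}, #|J| = 4%N & m *+ 2 = \sum_(i in J) l i + K8 *+ 2.
Proof.
move=> hl hf hm fm; have [mm mK] := hm.
pose a i := inter m (line_root l i).
have aE i : a i = inter (l i) m - 1 by rewrite /a inter_root mK interC.
have sum_a : \sum_i a i = - 4.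
  under eq_bigr do rewrite aE.
  have : inter (f *+ 2) m = 0 by rewrite interMnl fm mul0rn.
  rewrite hf interDl (interC (K8 *+ 4)) interMnr mK interC raddf_sum /=.
  under eq_bigr do rewrite interC.
  move/eqP; rewrite addr_eq0 => /eqP eS.
  by rewrite sumrB eS sumr_const card_ord.
have sq_a : \sum_i a i * a i = 4 by apply: line_sum_sq.
have a01 i : a i = - (inter (l i) m == 0)%:R.
  have : \sum_i a i * (a i + 1) = 0.
    under eq_bigr do rewrite mulrDr mulr1.
    by rewrite big_split /= sum_a sq_a.
  move/eqP; rewrite psumr_eq0 => [/allP/(_ i)|j _]; last first.
    by have [] := lerP 0 (a j); nia.
  rewrite mem_index_enum mulf_eq0 => /(_ isT)/=.
  by have := aE i; case: eqP; lia.
(* As [a i = (l i).m - 1], the four coordinates equal to -1 are the lines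
   orthogonal to [m]. *)
pose J := [set i | inter (l i) m == 0]%SET; have J4 : #|J| = 4%N.
  have : \sum_i a i = - #|J|%:R.
    rewrite -sum1_card natr_sum -sumrN [RHS]big_mkcond; apply: eq_bigr => i _.
    by rewrite a01 finset.inE; case: eqP.
  by rewrite sum_a; move: #|J| => n; lia.
exists J => //; apply/cornerP => //; split=> // i.
by rewrite finset.inE => /eqP.
Qed.

(** * Half-integral shifts *)

Lemma toQD x y : toQ (x + y) = toQ x + toQ y.
Proof. exact: map_mxD. Qed.

Lemma toQMn x n : toQ (x *+ n) = toQ x *+ n.
Proof. exact: (raddfMn (map_mx intr)). Qed.

Lemma toQ_inj : injective toQ.
Proof.
move=> x y /rowP e; apply/rowP => j; move: (e j); rewrite !mxE => /eqP.
by rewrite eqr_int => /eqP.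
Qed.

Lemma scale_half (v : PicQ) : 2^-1 *: (v *+ 2) = v.
Proof. by rewrite -scaler_nat scalerA mulVf // scale1r. Qed.

Lemma half_shift_corner A m : m *+ 2 = A + K8 *+ 2 -> half_shift A = toQ m.
Proof.
move=> hm; rewrite /half_shift -[toQ K8]scale_half -[RHS]scale_half.
by rewrite -scalerDr -!toQMn -toQD -hm.
Qed.

Lemma half_shift_inj : injective half_shift.
Proof. by move=> A B /addIr /(scalerI (isT : 2^-1 != 0 :> rat)) /toQ_inj. Qed.

Lemma pair_half_shift_inj : injective pair_half_shift.
Proof.
move=> S S' eS; apply/fsetP => A.
by rewrite -2!(mem_imfset imfset_key _ half_shift_inj) -!/(pair_half_shift _) eS.
Qed.

Lemma pair_half_shift2 A A' m m' :
  m *+ 2 = A + K8 *+ 2 -> m' *+ 2 = A' + K8 *+ 2 ->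
  pair_half_shift [fset A; A']%fset = pair_toQ [fset m; m']%fset.
Proof.
move=> hm hm'; rewrite /pair_half_shift /pair_toQ !imfset_fset2.
by rewrite (half_shift_corner hm) (half_shift_corner hm').
Qed.

(** * Simplices as sets of indices *)

Lemma line_frame_injective l : line_frame l -> injective l.
Proof.
move=> hl i j eij; apply/eqP; apply/negPn/negP => nij.
by have := line_frame_inter i j hl; rewrite {1}eij line_frame_inter // eqxx (negPf nij).
Qed.

Definition face (l : 'I_8 -> Pic) (J : {set 'I_8}) : {fset Pic} :=
  [fset l i | i in J]%fset.

Lemma mem_face l (J : {set 'I_8}) i : line_frame l -> (l i \in face l J) = (i \in J).
Proof. by move=> hl; rewrite (mem_imfset imfset_key _ (line_frame_injective hl)). Qed.

Lemma card_face l J : line_frame l -> #|` face l J|%fset = #|J|.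
Proof.
by move=> hl; rewrite (card_imfset imfset_key _ (line_frame_injective hl)) /= cardE.
Qed.

Lemma center_face l J : line_frame l -> center (face l J) = \sum_(i in J) l i.
Proof.
move=> hl; rewrite /center big_imfset /= ?big_enum //.
by move=> i j _ _; apply: (line_frame_injective hl).
Qed.

Lemma sub_faceP l J (Q : {fset Pic}) : line_frame l -> (Q `<=` face l J)%fset ->
  Q = face l [set i | l i \in Q]%SET.
Proof.
move=> hl sQ; apply/fsetP => x; apply/idP/imfsetP => [xQ|[i /= + ->]].
  have /imfsetP[i _ xi] := fsubsetP sQ x xQ.
  by exists i => //=; rewrite finset.inE -xi.
by rewrite finset.inE.
Qed.

Lemma A_polytope_frame P : A_polytope 7 P ->
  exists2 l, line_frame l & P = face l [set: 'I_8]%SET.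
Proof.
move=> [P8 Pline P1]; pose l (i : 'I_8) := nth 0 P i.
have lP i : l i \in P by apply: mem_nth; rewrite P8.
have lE i j : (l i == l j) = (i == j).
  by rewrite nth_uniq ?P8 ?fset_uniq.
exists l; first by split=> [i|i j ij]; [apply: Pline | apply: P1; rewrite ?lE].
apply/fsetP => x; apply/idP/imfsetP => [xP|[i _ ->] //].
have ltx : (index x P < 8)%N by move: xP; rewrite -index_mem P8.
by exists (Ordinal ltx); rewrite ?finset.inE //= /l nth_index.
Qed.

(** * Centers of cornered simplices and the seven pairs *)

(** The corner of a 3-simplex is what makes half of its sum of roots an integral
    class, so being cornered depends only on membership in the code. *)
Lemma cornered_A3_center_inP l A : line_frame l ->
  cornered_A3_center_in (face l [set: 'I_8]%SET) A <->
  exists J : {set 'I_8},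
    [/\ J \in frame_code (line_root l), #|J| = 4%N & A = \sum_(i in J) l i].
Proof.
move=> hl; split=> [[Q [sQ [Q4 _ _] [m [hm Qm]] ->]]|[J [hJ J4 ->]]].
  move: (sub_faceP hl sQ); set J := [set _ | _]%SET => eQ.
  have J4 : #|J| = 4%N by rewrite -(card_face _ hl) -eQ.
  exists J; split=> //; last by rewrite {1}eQ center_face.
  apply/tetrad_cornerP => //; exists m; apply/cornerP => //; split=> // i.
  by rewrite finset.inE => /Qm[].
have [m hm] := (tetrad_cornerP hl J4).1 hJ.
have [mline mJ] := (cornerP m hl J4).1 hm.
exists (face l J); split; last by rewrite center_face.
- by apply/fsubsetP => x /imfsetP[i _ ->]; rewrite mem_face ?finset.inE.
- split=> [|x /imfsetP[i _ ->]|x y /imfsetP[i _ ->] /imfsetP[j _ ->] ij].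
  + by rewrite card_face.
  + by case: hl.
  + by case: hl => _; apply; apply: contraNneq ij => ->.
- exists m; split=> // x /= /imfsetP[i /= iJ ->].
  by split; [case: hl | apply: mJ].
Qed.

Definition split_pair (l : 'I_8 -> Pic) (J : {set 'I_8}) : {fset Pic} :=
  [fset (\sum_(i in J) l i)%R; (\sum_(i in ~: J) l i)%R]%fset.

Lemma cardsC4 (J : {set 'I_8}) : #|J| = 4%N -> #|~: J| = 4%N.
Proof. by move=> J4; rewrite cardsCs finset.setCK card_ord J4. Qed.

Lemma fset2C (T : choiceType) (a b : T) : [fset a; b]%fset = [fset b; a]%fset.
Proof. exact: fsetUC. Qed.

(** Once the first center comes from a codeword [J], the second is the sum over
    [~: J], being the total center minus the first; the pair being unordered,
    [J] may be exchanged with its complement so as to contain [ord0]. *)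
Lemma center_pairsE l : line_frame l ->
  center_pairs (face l [set: 'I_8]%SET) =
  [set` [fset split_pair l J | J in pointed_tetrads (line_root l)]%fset].
Proof.
move=> hl; have hr := roots_frame hl.
have eT : \sum_(i in [set: 'I_8]%SET) l i = \sum_i l i.
  by apply: eq_bigl => i; rewrite finset.inE.
apply/seteqP; split=> S /=; rewrite /center_pairs /=.
  move=> [_ [D2 [/(cornered_A3_center_inP _ hl)[J [hJ J4 ->]] _ eD ->]]].
  have -> : D2 = \sum_(i in ~: J) l i.
    by rewrite sum_setC -eT -(center_face _ hl) -eD addrC addKr.
  apply/imfsetP; case: (boolP (ord0 \in J)) => J0.
    by exists J => //=; rewrite finset.in_set hJ J0 J4.
  exists (~: J) => /=; last by rewrite /split_pair finset.setCK fset2C.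
  by rewrite finset.in_set frame_code_setC //= finset.in_setC J0 cardsC4.
move=> /imfsetP[J /= + ->]; rewrite finset.in_set => /and3P[hJ _ /eqP J4].
exists (\sum_(i in J) l i), (\sum_(i in ~: J) l i); split=> //.
- by apply/cornered_A3_center_inP => //; exists J.
- apply/cornered_A3_center_inP => //; exists (~: J).
  by rewrite frame_code_setC ?cardsC4.
- by rewrite sum_setC center_face // eT addrC subrK.
Qed.

(** A sum of lines determines its index set, so two words with the same pair are
    equal or complementary, and the latter is excluded as both contain [ord0]. *)
Lemma card_center_pairs l : line_frame l ->
  center_pairs (face l [set: 'I_8]%SET) #= `I_7.
Proof.
move=> hl; rewrite center_pairsE //; apply/card_eq_fsetP.
rewrite card_in_imfset /= -?cardE; first exact: card_pointed_tetrads (roots_frame hl).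
move=> J J'; rewrite /= ![_ \in pointed_tetrads _]finset.in_set.
move=> /and3P[_ J0 _] /and3P[_ J'0 _] eJ.
have : \sum_(i in J) l i \in split_pair l J' by rewrite -eJ fset21.
case/fset2P => /(sum_lines_inj hl) // eJJ'.
by move: J0; rewrite eJJ' finset.in_setC J'0.
Qed.

(** Integrality of the ruling comes from the full word being a codeword: if
    [sum_i r_i = 2 t] then [t - 2 K8] is the required class. *)
Lemma frame_ruling l : line_frame l ->
  exists2 f, f *+ 2 = \sum_i l i + K8 *+ 4 & is_ruling f.
Proof.
move=> hl; have hr := roots_frame hl.
have /frame_codeP[t ht] := frame_code_setT hr.
have tr i : inter t (line_root l i) = -1.
  by rewrite (inter_half_sum i hr ht) finset.inE.
have tK : inter t K8 = 0.
  have : inter (t *+ 2) K8 = 0 by rewrite -ht inter_suml big1 // => i _; case: hr.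
  by rewrite interMnl; lia.
have tt : inter t t = -4.
  have := frame_parseval t t hr; rewrite tK.
  under eq_bigr do rewrite !tr.
  by rewrite sumr_const card_ord; lia.
exists (t - K8 *+ 2).
  rewrite mulrnBl -ht sum_roots cardsT card_ord -addrA -mulrnA -mulrnBr //.
  by congr (_ + _); apply: eq_bigl => i; rewrite finset.inE.
have fK : inter (t - K8 *+ 2) K8 = -2.
  by rewrite interC (interBr _ t) interMnr interKK interC tK.
split=> //; rewrite (interBr _ t) interMnr fK interC (interBr _ t) interMnr tK tt.
by [].
Qed.

Unset Implicit Arguments.

Theorem theorem29 (P : {fset Pic}) (hP : A_polytope 7 P) :
  exists f : Pic,
    [/\ toQ f = 2^-1 *: toQ (center P) + 2 *: toQ K8,
        is_ruling f,
        exists D1 D2 : Pic,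
          [/\ cornered_A3_center_in P D1, cornered_A3_center_in P D2
            & center P = D1 + D2],
        center_pairs P #= `I_7
      & set_bij (center_pairs P) (pair_toQ @` bipolar_pairs f)
          pair_half_shift].
Proof.
have [l hl ->] := A_polytope_frame hP.
have [f hf [ff fK]] := frame_ruling hl.
have card7 := card_center_pairs hl.
have eD : center (face l [set: 'I_8]%SET) = \sum_i l i.
  by rewrite center_face //; apply: eq_bigl => i; rewrite finset.inE.
exists f; split=> //.
- rewrite -[toQ f]scale_half -toQMn hf -eD toQD scalerDr toQMn; congr (_ + _).
  by rewrite (mulrnA _ 2 2) scale_half scaler_nat.
- have : center_pairs (face l [set: 'I_8]%SET) !=set0.
    apply/set0P; apply: contraTneq card7 => ->.
    rewrite card_eq_sym card_eq0; apply/set0P; by exists 0%N.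
  by case=> S [D1 [D2 [h1 h2 <- _]]]; exists D1, D2.
- split=> [S /=|S S' _ _|B /= [_ [m [m' [hm hm' mf mm' ->]]] <-]].
  + rewrite center_pairsE // => /imfsetP[J /= + ->].
    rewrite finset.in_set => /and3P[hJ _ /eqP J4].
    have [m hm] := (tetrad_cornerP hl J4).1 hJ.
    have [m' hm'] := (tetrad_cornerP hl (cardsC4 J4)).1
                       (frame_code_setC (roots_frame hl) hJ).
    rewrite (pair_half_shift2 hm hm'); exists [fset m; m']%fset => //.
    have [hml _] := (cornerP m hl J4).1 hm.
    have [hml' _] := (cornerP m' hl (cardsC4 J4)).1 hm'.
    have mf : m + m' = f.
      apply: mulrn2_inj; rewrite /= mulrnDl hm hm' hf sum_setC addrACA -mulrnDr.
      by rewrite [X in X + _]addrC subrK.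
    exists m, m'; split=> //.
    (* [f.f = 0] and [m.m = m'.m' = -1] force [m.m' = 1]. *)
    move: ff; rewrite -mf interDr !interDl (interC m' m).
    by case: hml => -> _; case: hml' => -> _; lia.
  + exact: pair_half_shift_inj.
  + have fm : inter f m = 0.
      by rewrite -mf interDl (interC m' m) mm'; case: hm => ->.
    have fm' : inter f m' = 0.
      by rewrite -mf interDl mm'; case: hm' => ->.
    have [J J4 hJ] := orthogonal_line_corner hl hf hm fm.
    have [J' J'4 hJ'] := orthogonal_line_corner hl hf hm' fm'.
    exists [fset (\sum_(i in J) l i)%R; (\sum_(i in J') l i)%R]%fset.
      exists (\sum_(i in J) l i), (\sum_(i in J') l i); split=> //.
      - apply/cornered_A3_center_inP => //; exists J; split=> //.
        by apply/tetrad_cornerP => //; exists m.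
      - apply/cornered_A3_center_inP => //; exists J'; split=> //.
        by apply/tetrad_cornerP => //; exists m'.
      rewrite eD; apply: (addIr (K8 *+ 4)); rewrite -hf -mf (mulrnDl _ m) hJ hJ'.
      by rewrite [RHS]addrACA -mulrnDr.
    exact: pair_half_shift2.
Qed.
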